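(* Let $N$ be a finite set of items with sizes $s(i)>0$, let $f:2^N\to\mathbb{R}_{\ge0}$ be normalized, monotone and submodular with $f(\{j\})>0$ for all $j$ and curvature $c\in(0,1]$, and let $\gamma>0$. Let $i_1,i_2,\dots$, $G_j$ and $k$ be as in the context, let $\mathrm{Opt}$ be an optimal solution for capacity $\gamma$, and assume $G_k\ne\mathrm{Opt}$. Then for all $j\in\{1,\dots,k\}$, $$f(G_j)\ge\frac{1}{c}\Bigl(1-\exp\Bigl(-c\,\frac{s(G_j)}{\gamma}\Bigr)\Bigr)f(\mathrm{Opt}).$$
   Context: $s(A)=\sum_{i\in A}s(i)$. $f$ normalized: $f(\emptyset)=0$; monotone: $f(A)\le f(B)$ for $A\subseteq B$; submodular: $f(A)+f(B)\ge f(A\cup B)+f(A\cap B)$. Curvature: $c=1-\min_{j\in N}\frac{f(N)-f(N\setminus\{j\})}{f(\{j\})}$. $\mathrm{Opt}$ maximizes $f(S)$ over $S\subseteq N$ with $s(S)\le\gamma$. Greedy order: $N_\gamma=\{i: s(i)\le\gamma\}$; $G_0=\emptyset$, and for $j=1,\dots,|N_\gamma|$, $i_j$ maximizes $\frac{f(G_{j-1}\cup\{i\})-f(G_{j-1})}{s(i)}$ over $i\in N_\gamma\setminus G_{j-1}$, $G_j=G_{j-1}\cup\{i_j\}$; $k$ is the largest index with $s(G_k)\le\gamma$. *)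

(* Defs.v *)
From mathcomp Require Import all_boot all_order all_algebra.
From mathcomp Require Import reals.

Set Implicit Arguments.
Unset Strict Implicit.
Unset Printing Implicit Defensive.
Import Order.TTheory GRing.Theory Num.Theory.
Local Open Scope ring_scope.

Section Knapsack.
Variables (R : realType) (N : finType).
Implicit Types (s : N -> R) (f : {set N} -> R) (gamma : R).

Definition total_size s (A : {set N}) : R := \sum_(i in A) s i.

Definition normalized f : Prop := f set0 = 0.

Definition monotone f : Prop :=
  forall A B : {set N}, A \subset B -> f A <= f B.

Definition submodular f : Prop :=
  forall A B : {set N}, f (A :|: B) + f (A :&: B) <= f A + f B.

Definition curvature_ratio f (j : N) : R :=
  (f [set: N] - f ([set: N] :\ j)) / f [set j].

(* The minimum defining the curvature is attained at some j; stating it as a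
   relation avoids a default value for the minimum over an empty N, for which
   no c is a curvature. *)
Definition is_curvature f (c : R) : Prop :=
  exists2 j : N, c = 1 - curvature_ratio f j
               & forall l : N, curvature_ratio f j <= curvature_ratio f l.

Definition is_optimal f s gamma (Opt : {set N}) : Prop :=
  total_size s Opt <= gamma /\
  forall S : {set N}, total_size s S <= gamma -> f S <= f Opt.

Definition fitting s gamma : {set N} := [set i | s i <= gamma].

Definition marginal_density f s (A : {set N}) (i : N) : R :=
  (f (i |: A) - f A) / s i.

Definition prefix_set (m : nat) (g : m.-tuple N) (j : nat) : {set N} :=
  [set i in take j g].

(* [tnth g j] is the item i_{j+1} of a 1-based enumeration, chosen when the
   current set is G_j = prefix_set g j. Ties may be broken arbitrarily. *)
Definition greedy_order f s gamma
    (g : #|fitting s gamma|.-tuple N) : Prop :=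
  forall j : 'I_#|fitting s gamma|,
    tnth g j \in fitting s gamma :\: prefix_set g j /\
    forall i : N, i \in fitting s gamma :\: prefix_set g j ->
      marginal_density f s (prefix_set g j) i
        <= marginal_density f s (prefix_set g j) (tnth g j).

Definition is_last_feasible s gamma (m : nat) (g : m.-tuple N)
    (k : nat) : Prop :=
  [/\ (k <= m)%N,
      total_size s (prefix_set g k) <= gamma
    & forall l : nat, (l <= m)%N ->
        total_size s (prefix_set g l) <= gamma -> (l <= k)%N].

End Knapsack.

(* Main.v *)
Require Import Defs.
From mathcomp Require Import all_boot all_order all_algebra.
From mathcomp Require Import reals sequences exp.
From mathcomp Require Import ring lra.
Import Order.TTheory GRing.Theory Num.Theory.
Local Open Scope ring_scope.

(** For a greedy set G put r = f(Opt ∪ G) - f(G), b = gamma - s(G ∩ Opt), and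
    let T be the size still to be collected on the way to G_j. Greedy choice
    gives density at least r/b to the next item, and adding an item of gain x
    lowers r by x if it lies in Opt (then b also drops by its size), and by at
    most c x otherwise. By backward induction the remaining gain is at least
    (r/c)(1 - exp(-c T/b)): an item outside Opt costs the usual
    1 - t <= exp(-t), while for an item of Opt one uses that T <= b, which
    holds because s(G_j) <= gamma. At G = ∅ this is the claim. *)

Section RecursionBounds.
Local Set Implicit Arguments.
Local Unset Strict Implicit.
Variable R : realType.
Implicit Types b c p r u x T sz : R.

(** With [E = expR (- c * u)], the right side is [E * expR (- c * p * (1 - u))]. Bounding the second
    factor by its tangent line leaves [p * (E * (1 - c * (1 - u)) - (1 - c)) >= 0], which follows
    from [E >= 1 - c * u]. *)
Lemma expR_mix_ge c p u : 0 < c -> c <= 1 -> 0 <= p -> 0 <= u -> u <= 1 ->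
  p * (1 - c) + (1 - p) * expR (- c * u) <= expR (- c * (p + (1 - p) * u)).
Proof.
move=> c0 c1 p0 u0 u1.
have -> : - c * (p + (1 - p) * u) = - c * u + (- c * p * (1 - u)) by ring.
rewrite expRD.
have E0 := expR_gt0 (- c * u).
have E1 := expR_ge1Dx (- c * u).
have E2 := expR_ge1Dx (- c * p * (1 - u)).
set E := expR (- c * u) in E0 E1 *; set D := expR _ in E2 *.
have ED : E * (1 - c * p * (1 - u)) <= E * D by rewrite ler_pM2l //; lra.
have q0 : 0 <= 1 - c * (1 - u) by nra.
have K : (1 - c * u) * (1 - c * (1 - u)) <= E * (1 - c * (1 - u)).
  by apply: ler_wpM2r => //; lra.
have L : 0 <= E * (1 - c * (1 - u)) - (1 - c).
  (* The middle term is [(1 - c * u) * (1 - c * (1 - u)) - (1 - c)]. *)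
  apply: (@le_trans _ _ (c * c * (u * (1 - u)))); last lra.
  by rewrite !mulr_ge0 ?subr_ge0 // ltW.
have := mulr_ge0 p0 L; lra.
Qed.

(* When [sz = b] also [T = sz], and the junk value [0 / 0 = 0] is the right one. *)
Lemma optimal_item_bound c r b T sz x :
  0 < c -> c <= 1 -> 0 <= r -> 0 < b -> 0 <= sz -> sz <= T -> T <= b ->
  r * sz <= b * x ->
  r * (1 - expR (- c * (T / b))) <=
    c * x + (r - x) * (1 - expR (- c * ((T - sz) / (b - sz)))).
Proof.
move=> c0 c1 r0 b0 sz0 szT Tb rx.
set u := (T - sz) / (b - sz); set p := sz / b.
have bz : 0 <= b - sz by lra.
have u0 : 0 <= u by apply: divr_ge0 => //; lra.
have u1 : u <= 1.
  have [bz0|bz0] := eqVneq (b - sz) 0; first by rewrite /u bz0 invr0 mulr0.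
  by rewrite ler_pdivrMr ?mul1r ?lerD2r // lt_def bz0.
have p0 : 0 <= p by apply: divr_ge0 => //; exact: ltW.
have Tsz : u * (b - sz) = T - sz.
  have [bz0|bz0] := eqVneq (b - sz) 0; last by rewrite divfK.
  by rewrite bz0 mulr0; lra.
(* [T / b] is the average of 1 and [u] with weights [p] and [1 - p], the shape required by
   [expR_mix_ge]. *)
have -> : T / b = p + (1 - p) * u.
  have -> : T = sz + u * (b - sz) by rewrite Tsz; ring.
  by rewrite /p; field; rewrite gt_eqF.
have xp : r * p <= x by rewrite /p mulrA ler_pdivrMr // (mulrC x).
have mix := expR_mix_ge c0 c1 p0 u0 u1.
have E1 := expR_ge1Dx (- c * u).
set E := expR (- c * u) in mix E1 *; set D := expR _ in mix *.
(* This is the coefficient of [x] on the right of the goal. It is nonnegative because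
   [1 - E <= c * u <= c], so [x] may be replaced by its lower bound [r * p]. *)
have A : (c - (1 - E)) * (r * p) <= (c - (1 - E)) * x.
  by apply: ler_wpM2l => //; nra.
have := ler_wpM2l r0 mix; lra.
Qed.

(** Splitting off the factor [expR (- c * ((T - sz) / b))] reduces the claim to
    [r - c * x <= r * expR (- c * (sz / b))], a tangent-line bound. *)
Lemma nonoptimal_item_bound c r b T sz x :
  0 <= c -> 0 <= r -> 0 < b -> r * sz <= b * x ->
  r * (1 - expR (- c * (T / b))) <=
    c * x + (r - c * x) * (1 - expR (- c * ((T - sz) / b))).
Proof.
move=> c0 r0 b0 rx.
have -> : - c * (T / b) = - c * (sz / b) + - c * ((T - sz) / b).
  by field; rewrite gt_eqF.
rewrite expRD.
have xp : r * (sz / b) <= x by rewrite mulrA ler_pdivrMr // (mulrC x).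
have E1 := ler_wpM2l r0 (expR_ge1Dx (- c * (sz / b))).
have D0 := expR_ge0 (- c * ((T - sz) / b)).
set E := expR (- c * (sz / b)) in E1 *; set D := expR _ in D0 *.
have rE : 0 <= r * E - (r - c * x).
  have := ler_wpM2l c0 xp; lra.
have := mulr_ge0 rE D0; lra.
Qed.

End RecursionBounds.

Section SetFunctions.
Local Set Implicit Arguments.
Local Unset Strict Implicit.
Variables (R : realType) (N : finType).
Implicit Types (f : {set N} -> R) (s : N -> R) (A B : {set N}) (i : N).

Lemma total_size_setU1 s A i :
  i \notin A -> total_size s (i |: A) = s i + total_size s A.
Proof. exact: big_setU1. Qed.

Lemma total_size_setID s A B :
  total_size s A = total_size s (A :&: B) + total_size s (A :\: B).
Proof. exact: big_setID. Qed.

Lemma total_size_ge0 s A : (forall i, 0 <= s i) -> 0 <= total_size s A.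
Proof. by move=> s0; apply: sumr_ge0. Qed.

Lemma total_size_subset s A B :
  (forall i, 0 <= s i) -> A \subset B -> total_size s A <= total_size s B.
Proof.
move=> s0 AB; rewrite (total_size_setID s B A) (setIidPr AB) lerDl.
exact: total_size_ge0.
Qed.

Lemma submodular_marginal f A B i : submodular f -> A \subset B -> i \notin B ->
  f (i |: B) - f B <= f (i |: A) - f A.
Proof.
move=> f_sub AB iB; have := f_sub (i |: A) B.
have -> : (i |: A) :|: B = i |: B by rewrite -setUA (setUidPr AB).
have -> : (i |: A) :&: B = A.
  rewrite setIUl (setIidPl AB); apply/setUidPr/subsetP => y.
  by rewrite !inE => /andP[/eqP-> yB]; rewrite yB in iB.
lra.
Qed.

(** By submodularity the gain of [i] is smallest on top of all other items, and [1 - c] is the least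
    curvature ratio. *)
Lemma curvature_marginal f c A i : submodular f -> (forall j, 0 < f [set j]) ->
  is_curvature f c -> i \notin A -> (1 - c) * f [set i] <= f (i |: A) - f A.
Proof.
move=> f_sub f1 [j cE jmin] iA.
have AD : A \subset [set: N] :\ i by rewrite subsetD1 subsetT.
have := submodular_marginal f_sub AD (negbT (setD11 i _)).
rewrite setD1K ?in_setT //; apply: le_trans.
by rewrite cE opprB addrCA subrr addr0 -ler_pdivlMr //; exact: jmin.
Qed.

Lemma submodular_union_bound f A (t : seq N) : monotone f -> submodular f ->
  f (A :|: [set i in t]) - f A <= \sum_(i <- t) (f (i |: A) - f A).
Proof.
move=> f_mono f_sub; elim: t => [|i t IH].
  by rewrite big_nil set_nil setU0 subrr.
rewrite big_cons set_cons setUCA.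
set B := A :|: _ in IH *.
have : f (i |: B) - f B <= f (i |: A) - f A.
  have [iB|iB] := boolP (i \in B); last first.
    by apply: submodular_marginal => //; exact: subsetUl.
  rewrite (setUidPr _) ?sub1set // subrr subr_ge0.
  exact/f_mono/subsetUr.
lra.
Qed.

Lemma gap_le_density f s A B d : monotone f -> submodular f ->
  (forall i, 0 < s i) ->
  (forall i, i \in B :\: A -> marginal_density f s A i <= d) ->
  f (B :|: A) - f A <= d * total_size s (B :\: A).
Proof.
move=> f_mono f_sub s0 dmax.
have := submodular_union_bound A (enum (B :\: A)) f_mono f_sub.
have -> : A :|: [set i in enum (B :\: A)] = B :|: A.
  by rewrite set_enum setDE setUIr setUCr setIT setUC.
move=> /le_trans; apply.
rewrite big_enum /total_size mulr_sumr ler_sum // => i /dmax.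
by rewrite ler_pdivrMr.
Qed.

End SetFunctions.

Theorem theorem5 (R : realType) (N : finType) (s : N -> R)
    (f : {set N} -> R) (c gamma : R)
    (s_gt0 : forall i : N, 0 < s i)
    (f_ge0 : forall A : {set N}, 0 <= f A)
    (f_norm : normalized f) (f_mono : monotone f) (f_sub : submodular f)
    (f1_gt0 : forall j : N, 0 < f [set j])
    (c_curv : is_curvature f c) (c_gt0 : 0 < c) (c_le1 : c <= 1)
    (gamma_gt0 : 0 < gamma)
    (g : #|fitting s gamma|.-tuple N) (g_greedy : greedy_order f g)
    (k : nat) (k_last : is_last_feasible s gamma g k)
    (Opt : {set N}) (Opt_opt : is_optimal f s gamma Opt)
    (Gk_neq_Opt : prefix_set g k <> Opt) :
  forall j : nat, (1 <= j <= k)%N ->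
    f (prefix_set g j) >=
      c^-1 * (1 - expR (- c * (total_size s (prefix_set g j) / gamma))) * f Opt.
Proof.
move=> j /andP[_ jk].
have [km Gk_size _] := k_last.
have s_ge0 i : 0 <= s i by exact: ltW.
have G_step l : (l < j)%N -> exists i, [/\ i \notin prefix_set g l,
    prefix_set g l.+1 = i |: prefix_set g l
  & forall i', i' \in Opt :\: prefix_set g l ->
      marginal_density f s (prefix_set g l) i'
        <= marginal_density f s (prefix_set g l) i].
  move=> lj; have lm : (l < #|fitting s gamma|)%N.
    exact: leq_trans lj (leq_trans jk km).
  have [+ imax] := g_greedy (Ordinal lm); set i := tnth g _ => /=.
  rewrite inE => /andP[iG _]; exists i; split => //.
    apply/setP => y; rewrite !inE (take_nth i) ?size_tuple // mem_rcons inE.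
    by rewrite -(tnth_nth i g (Ordinal lm)).
  (* An item of [Opt] fits on its own, since its size is at most that of [Opt]; hence it competes in
     the greedy choice. *)
  move=> i'; rewrite inE => /andP[i'G i'O]; apply: imax; rewrite !inE in i'G *.
  rewrite i'G; apply: le_trans Opt_opt.1.
  have := @total_size_subset R N s [set i'] Opt s_ge0.
  by rewrite sub1set /total_size big_set1; apply.
have G_mono l n : (l <= n)%N -> prefix_set g l \subset prefix_set g n.
  move=> ln; apply/subsetP => y; rewrite !inE.
  by rewrite -(take_takel _ ln); exact: mem_take.
set Gj := prefix_set g j.
have Gj_size : total_size s Gj <= gamma.
  by apply: le_trans Gk_size; apply: total_size_subset => //; exact: G_mono.
pose T l := total_size s Gj - total_size s (prefix_set g l).
pose b l := gamma - total_size s (prefix_set g l :&: Opt).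
pose r l := f (Opt :|: prefix_set g l) - f (prefix_set g l).
have main d l : (l + d = j)%N ->
    r l * (1 - expR (- c * (T l / b l))) <= c * (f Gj - f (prefix_set g l)).
  elim: d l => [|d IH] l.
    (* Here [T j = 0], so the quotient vanishes even if [b j = 0]. *)
    by rewrite addn0 => ->; rewrite /T !subrr mul0r mulr0 expR0 subrr !mulr0.
  rewrite addnS => ldj; have lj : (l < j)%N by rewrite -ldj ltnS leq_addr.
  have {IH} := IH l.+1 ldj.
  have [i [iG GS imax]] := G_step l lj.
  have := G_mono _ _ lj; rewrite GS => iGj.
  have TS : T l.+1 = T l - s i by rewrite /T GS total_size_setU1 //; lra.
  have siT : s i <= T l.
    by rewrite -subr_ge0 -TS /T subr_ge0 GS total_size_subset.
  have Tb : T l <= b l.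
    by rewrite /T /b lerB // total_size_subset // subsetIl.
  have b0 : 0 < b l by apply: lt_le_trans Tb; exact: lt_le_trans siT.
  have r0 : 0 <= r l by rewrite subr_ge0 f_mono // subsetUr.
  set G := prefix_set g l in iG GS imax iGj *.
  set x := f (i |: G) - f G.
  have x0 : 0 <= x by rewrite subr_ge0 f_mono // subsetUr.
  (* [r l] is at most the density of [i] times the size of [Opt :\: G], and that size is at most
     [b l] because [Opt] fits in [gamma]. *)
  have rx : r l * s i <= b l * x.
    have gap := gap_le_density f_mono f_sub s_gt0 imax.
    have xE : x = marginal_density f s G i * s i by rewrite divfK ?gt_eqF.
    rewrite xE mulrA ler_pM2r // mulrC; apply: le_trans gap _.
    rewrite ler_wpM2l ?divr_ge0 // /b setIC lerBrDl -total_size_setID.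
    exact: Opt_opt.1.
  have fiG : f (i |: G) = f G + x by rewrite /x; ring.
  have [iO|iO] := boolP (i \in Opt).
    have -> : b l.+1 = b l - s i.
      rewrite /b GS setIUl (setIidPl _) ?sub1set // total_size_setU1; last first.
        by rewrite inE (negbTE iG).
      lra.
    (* [Opt :|: G] already contains [i], so only the subtracted [f G] changes. *)
    have -> : r l.+1 = r l - x.
      rewrite /r GS setUCA (setUidPr (_ : _ \subset _)); last first.
        by rewrite sub1set inE iO.
      rewrite -/G; lra.
    rewrite TS fiG => IH.
    have := optimal_item_bound c_gt0 c_le1 r0 b0 (s_ge0 i) siT Tb rx.
    lra.
  have -> : b l.+1 = b l.
    rewrite /b GS setIUl (_ : [set i] :&: Opt = set0) ?set0U //.
    by apply/eqP; rewrite setI_eq0 disjoints1.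
  rewrite TS fiG => IH.
  (* [f G] grows by [x], while [f (Opt :|: G)] grows by at least [(1 - c) * f [set i] >= (1 - c) *
     x]. *)
  have rS : r l - c * x <= r l.+1.
    have iOG : i \notin Opt :|: G by rewrite inE negb_or iO iG.
    have := curvature_marginal f_sub f1_gt0 c_curv iOG.
    have x1 : x <= f [set i].
      have := submodular_marginal f_sub (sub0set G) iG.
      by rewrite setU0 f_norm subr0.
    have c1 : 0 <= 1 - c by lra.
    have := ler_wpM2l c1 x1.
    rewrite /r GS setUCA -/G; lra.
  have e0 : 0 <= 1 - expR (- c * ((T l - s i) / b l)).
    rewrite subr_ge0 expR_le1 mulNr oppr_le0 mulr_ge0 ?(ltW c_gt0) //.
    by rewrite divr_ge0 ?(ltW b0) ?subr_ge0.
  have := ler_wpM2r e0 rS.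
  have := nonoptimal_item_bound (T l) (ltW c_gt0) r0 b0 rx.
  lra.
(* At the empty prefix, [r] is [f Opt], [T] is the size of [Gj] and [b] is [gamma]. *)
have := main j 0%N (add0n j).
have G0 : prefix_set g 0 = set0 by apply/setP => y; rewrite !inE take0.
rewrite /r /T /b G0 set0I setU0 f_norm /total_size big_set0 !subr0 => H.
by rewrite -mulrA ler_pdivrMl // mulrC.
Qed.
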